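(* Under Assumptions 1 through 9 listed in the context, for $x_{10}\in\Omega$: (1) $$\sigma^{*2}_{ncqte}(x_{10})=E\left[(m_{1,\tau}(X)-m_{0,\tau}(X))^2+\frac{\sigma^2_{\tau,1}(X)}{p(X)}+\frac{\sigma^2_{\tau,0}(X)}{1-p(X)}\,\Big|\,X_1=x_{10}\right];$$ (2) $$\sigma^2_{pcqte}(x_{10})=\sigma^{*2}_{ncqte}(x_{10})+E\left[p(X)(1-p(X))\left(\frac{m_{1,\tau}(X)}{p(X)}+\frac{m_{0,\tau}(X)}{1-p(X)}\right)^2\,\Big|\,X_1=x_{10}\right]\ge\sigma^{*2}_{ncqte}(x_{10}),$$ where $\sigma^2_{\tau,j}(x)=\mathrm{Var}\left(\frac{\mathbb I(Y(j)\le q_{j,\tau}(x_{10}))-\tau}{f_j(q_{j,\tau}(x_{10})\mid x_{10})}\,\Big|\,X=x\right)$, $j=0,1$.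
   Context: Setting. Fix $k\ge2$, $1\le l<k$, $\tau\in(0,1)$. $(X_i,Y_i(1),Y_i(0),D_i)$, $i=1,\dots,n$, are i.i.d. copies of $(X,Y(1),Y(0),D)$, where $X\in\mathbb R^k$ are covariates, $D\in\{0,1\}$ is the treatment indicator, $Y(0),Y(1)$ are real potential outcomes. The observed outcome is $Y=DY(1)+(1-D)Y(0)$; $Z=(X,D,Y)$. $X_1\in\mathbb R^l$ is a subvector of $X$. $p(X)=E(D\mid X)$ is the propensity score. $\Omega$ is the set of interior points of the support of $X_1$. $f$ is the density of $X_1$; $F_j(\cdot\mid x_1)$ and $f_j(\cdot\mid x_1)$ are the conditional distribution function and density of $Y(j)$ given $X_1=x_1$, $j=0,1$. With $\rho_\tau(u)=u(\tau-\mathbb I(u<0))$, $q_{j,\tau}(x_{1})=\arg\min_a E[\rho_\tau(Y(j)-a)\mid X_1=x_{1}]$, with gradient $q'_{j,\tau}$. Variance functions. $\tilde q_{j,\tau}(X_{1})=q_{j,\tau}(x_{10})+q'_{j,\tau}(x_{10})(X_{1}-x_{10})$; $\eta_{j,\tau}(Y)=\frac{\mathbb I(Y\le\tilde q_{j,\tau}(X_{1}))-\tau}{f_j(q_{j,\tau}(x_{10})\mid x_{10})}$; $m_{j,\tau}(X)=\frac{E[\mathbb I(Y(j)\le\tilde q_{j,\tau}(X_{1}))-\tau\mid X]}{f_j(q_{j,\tau}(x_{10})\mid x_{10})}$; $\psi(p(X),Z)=\frac{D}{p(X)}\eta_{1,\tau}(Y)-\frac{1-D}{1-p(X)}\eta_{0,\tau}(Y)$;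 $\epsilon=D-p(X)$; $n_p(X)=\frac{m_{1,\tau}(X)}{p(X)}+\frac{m_{0,\tau}(X)}{1-p(X)}$; $\phi_2(p(X),Z)=\psi(p(X),Z)-n_p(X)\epsilon$. Then $\sigma^2_{pcqte}(x_{10})=E(\psi^2(p(X),Z)\mid X_1=x_{10})$ and $\sigma^{*2}_{ncqte}(x_{10})=E(\phi_2^2(p(X),Z)\mid X_1=x_{10})$. (Multiplied by $\|K\|_2^2/f(x_{10})$, these are the asymptotic variances of the inverse-propensity-weighted local linear estimators of the conditional quantile treatment effect $q_{1,\tau}(x_{10})-q_{0,\tau}(x_{10})$ with parametrically, respectively kernel-, estimated propensity score.) Kernels. $g:\mathbb R^r\to\mathbb R$ is a kernel of order $s$ if $\int g=1$, $\int u_1^{p_1}\cdots u_r^{p_r}g(u)\,du=0$ for all nonnegative integers with $1\le\sum p_i<s$, and this integral is nonzero when $\sum p_i=s$. Assumption 1. (i) $(Y(0),Y(1))\perp D\mid X$. (ii) For some very small $c>0$, $c<p(X)<1-c$. Assumption 2. For any $\tau\in(0,1)$, $j=0,1$, $x_{10}\in\Omega$: (i) $q_{j,\tau}(x_{10})$ is the unique $\tau$th conditional quantile of $Y(j)\mid X_1=x_{10}$; (ii) $q_{j,\tau}(\cdot)$ is $s_1\ge2$ times continuously differentiable; (iii) $F_j(y\mid X_1)$ and $f_j(y\mid X_1)$ are bounded and uniformly continuous in $y$. Assumption 3. (i) The support $\chi$ of $X$ is a Cartesian product of compact intervals; the density of $X$ is bounded away from zero and infinity and $s_1\ge2$ times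 continuously differentiable. (ii) $f$ and $f_j(\cdot\mid X_1)$ are bounded away from zero and infinity and continuously differentiable. Assumption 4. $K:\mathbb R^l\to\mathbb R$ is a kernel of order $s_1$, symmetric around zero, and $s^*$ times continuously differentiable, with $s^*\ge s\ge k+l$. Assumption 5. As $n\to\infty$: $h\to0$, $nh^l\to\infty$, $nh^{2s_1+l+2}\to0$. Assumption 6 (for the parametric estimator). The estimator $\hat\beta$ of the propensity score model $\pi(X,\beta)$, $\beta\in\Theta\subset\mathbb R^d$, $d<\infty$, satisfies $\sup_{X\in\chi}|\pi(X,\hat\beta)-\pi(X,\beta_0)|=O_p(n^{-1/2})$, where $p(X)=\pi(X,\beta_0)$ for all $X\in\chi$. Assumption 7 (for the kernel estimator with kernel $L$ and bandwidth $h_0$). $L:\mathbb R^k\to\mathbb R$ is a kernel of order $s\ge k+l$, symmetric around zero, with finite support $[-M,M]^k$, and its $(s+1)$th derivative is continuous. The density of $X$ is $s$ times continuously differentiable and bounded away from zero and infinity. Assumption 8. $h_0\to0$ and $\log(n)/(nh_0^{k+s})\to0$. Assumption 9. $h_0^{2s}h^{-2s-l}\to0$ and $nh^{-l}h_0^{2s}\to0$. *)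

(* Defs.v *)
From HB Require Import structures.
From mathcomp Require Import all_boot all_order all_algebra perm.
From mathcomp Require Import all_classical all_reals all_analysis.
From mathcomp Require Import measurable_realfun.

Set Implicit Arguments.
Unset Strict Implicit.
Unset Printing Implicit Defensive.

Import Order.TTheory GRing.Theory Num.Theory.
Import numFieldNormedType.Exports.

Local Open Scope classical_set_scope.
Local Open Scope ring_scope.

Definition rV_display : measure_display.
Proof. exact: default_measure_display. Qed.

(* Borel sigma-algebra of R^n, generated by the coordinate projections. *)
Section rV_measurable.
Context {R : realType}.
Variable n : nat.

Definition rV_coord (i : 'I_n) (v : 'rV[R]_n) : measurableTypeR R := v 0 i.

Let rV0 : g_sigma_preimage rV_coord set0.
Proof. exact: sigma_algebra0. Qed.

Let rVC A : g_sigma_preimage rV_coord A -> g_sigma_preimage rV_coord (~` A).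
Proof. exact: sigma_algebraC. Qed.

Let rVU (F : (set 'rV[R]_n)^nat) :
  (forall i, g_sigma_preimage rV_coord (F i)) ->
  g_sigma_preimage rV_coord (\bigcup_i (F i)).
Proof. exact: sigma_algebra_bigcup. Qed.

HB.instance Definition _ := @isMeasurable.Build rV_display
  'rV[R]_n (g_sigma_preimage rV_coord) rV0 rVC rVU.

End rV_measurable.

Lemma measurable_rV_coord (R : realType) n (i : 'I_n) :
  measurable_fun [set: 'rV[R]_n] (rV_coord i).
Proof.
move=> _ Y mY; rewrite setTI; apply: sub_sigma_algebra => /=.
rewrite -bigcup_seq/=; exists i => /=; first by rewrite mem_index_enum.
by exists Y => //; rewrite setTI.
Qed.

Lemma measurable_fun_rV (R : realType) d (T : measurableType d) n
    (f : T -> 'rV[R]_n) :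
  (forall i, measurable_fun [set: T] (rV_coord i \o f)) ->
  measurable_fun [set: T] f.
Proof.
move=> mf; pose G := [set A : set 'rV[R]_n | measurable (f @^-1` A)].
suff mG : measurable `<=` G by move=> _ A mA; rewrite setTI; exact: mG.
apply: smallest_sub.
  split => /=.
  - by rewrite /G /= preimage_set0.
  - move=> A; rewrite /G /= => mA; rewrite setTD preimage_setC.
    exact: measurableC.
  - move=> F mF; rewrite /G /= preimage_bigcup.
    by apply: bigcup_measurable => i _; exact: mF.
rewrite -bigcup_seq; apply: bigcup_sub => i _ A [B mB <-].
rewrite setTI /G /= -comp_preimage.
by rewrite -[X in measurable X]setTI; exact: mf.
Qed.

(* Lebesgue measure on R^n, by identifying R^(n+1) with R x R^n. *)
Section lebesgue_rV.
Context {R : realType}.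

Definition rV_cons n (p : measurableTypeR R * 'rV[R]_n) : 'rV[R]_n.+1 :=
  \row_(i < n.+1) if unlift ord0 i is Some j then p.2 0 j else p.1.

Definition rV_uncons n (v : 'rV[R]_n.+1) : measurableTypeR R * 'rV[R]_n :=
  (v 0 ord0, \row_j v 0 (lift ord0 j)).

Lemma rV_consK n : cancel (@rV_cons n) (@rV_uncons n).
Proof.
move=> [t v]; congr pair; first by rewrite mxE unlift_none.
by apply/rowP => j; rewrite !mxE liftK.
Qed.

Lemma measurable_rV_cons n : measurable_fun setT (@rV_cons n).
Proof.
apply: measurable_fun_rV => i.
rewrite (_ : _ \o _ =
  fun p => if unlift ord0 i is Some j then rV_coord j p.2 else p.1); last first.
  by apply/funext => p /=; rewrite /rV_coord mxE; case: unliftP.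
case: unliftP => [j _|_]; last exact: measurable_fst.
by apply: measurableT_comp => //; exact: measurable_rV_coord.
Qed.

Lemma measurable_rV_uncons n : measurable_fun setT (@rV_uncons n).
Proof.
apply: measurable_fun_pair.
  exact: measurable_rV_coord.
apply: measurable_fun_rV => i.
rewrite (_ : _ \o _ = rV_coord (lift ord0 i)); first exact: measurable_rV_coord.
by apply/funext => v /=; rewrite /rV_coord mxE.
Qed.

Section step.
Variables (n : nat) (mu : {sigma_finite_measure set 'rV[R]_n -> \bar R}).

Definition lebesgue_cons : set 'rV[R]_n.+1 -> \bar R :=
  pushforward (lebesgue_measure \x mu)%E (@rV_cons n).

Let prod := (@lebesgue_measure R \x mu)%E.

Let cons0 : lebesgue_cons set0 = 0%E.
Proof. by rewrite /lebesgue_cons /pushforward preimage_set0 measure0. Qed.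

Let cons_ge0 A : (0 <= lebesgue_cons A)%E.
Proof. exact: (measure_ge0 prod). Qed.

Let cons_sigma_additive : semi_sigma_additive lebesgue_cons.
Proof.
move=> F mF tF mUF; rewrite /lebesgue_cons /pushforward preimage_bigcup.
apply: measure_semi_sigma_additive.
- by move=> i; rewrite -[X in measurable X]setTI; exact: measurable_rV_cons.
- apply/trivIsetP => /= i j _ _ ij; rewrite -preimage_setI.
  by move/trivIsetP : tF => /(_ _ _ _ _ ij) ->//; rewrite preimage_set0.
- rewrite -preimage_bigcup -[X in measurable X]setTI.
  exact: measurable_rV_cons.
Qed.

HB.instance Definition _ := isMeasure.Build _ _ _ lebesgue_cons
  cons0 cons_ge0 cons_sigma_additive.

Let prod_sigma_finite : sigma_finite setT prod.
Proof.
have /sigma_finiteP[F [TF ndF Foo]] := sigma_finiteT (@lebesgue_measure R).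
have /sigma_finiteP[G [TG ndG Goo]] := sigma_finiteT mu.
exists (fun i => F i `*` G i).
  rewrite -setXTT TF TG predeqE => -[x y]; split.
    move=> [/= [i _ Fix] [k _ Gky]]; exists (maxn i k) => //; split.
    - by move: x Fix; exact/subsetPset/ndF/leq_maxl.
    - by move: y Gky; exact/subsetPset/ndG/leq_maxr.
  by move=> [i _ []/= ? ?]; split; exists i.
move=> k; have [? ?] := Foo k; have [? ?] := Goo k.
split; first exact: measurableX.
by rewrite /prod product_measure1E// lte_mul_pinfty// ge0_fin_numE.
Qed.

Let cons_sigma_finite : sigma_finite setT lebesgue_cons.
Proof.
have [F FT Foo] := prod_sigma_finite.
exists (fun i => @rV_uncons n @^-1` F i).
  by rewrite -preimage_bigcup -FT preimage_setT.
move=> i; have [mF Fi] := Foo i; split.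
  by rewrite -[X in measurable X]setTI; exact: measurable_rV_uncons.
rewrite /lebesgue_cons /pushforward -comp_preimage.
rewrite (_ : @rV_uncons n \o @rV_cons n = id) ?preimage_id//.
by apply/funext => p; exact: rV_consK.
Qed.

HB.instance Definition _ := Measure_isSigmaFinite.Build _ _ _ lebesgue_cons
  cons_sigma_finite.

End step.

Fixpoint lebesgue_rV n : {sigma_finite_measure set 'rV[R]_n -> \bar R} :=
  if n is n'.+1 then lebesgue_cons (lebesgue_rV n')
  else dirac (0 : 'rV[R]_0).

End lebesgue_rV.

Section generic.
Context {R : realType}.

(* C^m on the open set U: all iterated directional derivatives of order at most
   m exist and are continuous on U. *)
Fixpoint Cm (V : normedModType R) (m : nat) (U : set V) (f : V -> R) : Prop :=
  (forall x, U x -> {for x, continuous f}) /\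
  (if m is m'.+1 then
     forall v, (forall x, U x -> derivable f x v) /\ Cm m' U ('D_v f)
   else True).

(* C^m on a set that need not be open: restriction of a C^m function. *)
Definition Cm_on (V : normedModType R) (m : nat) (A : set V) (f : V -> R) :=
  exists2 g : V -> R, Cm m setT g & forall x, A x -> f x = g x.

Definition gradient n (f : 'rV[R]_n -> R) (x : 'rV[R]_n) : 'rV[R]_n :=
  \row_i 'D_(delta_mx 0 i) f x.

Definition dot n (u v : 'rV[R]_n) : R := \sum_i u 0 i * v 0 i.

Definition bounded_away (V : Type) (A : set V) (f : V -> R) :=
  exists c C : R, 0 < c /\ forall x, A x -> c <= f x <= C.

Definition bounded_on (A : set R) (f : R -> R) :=
  exists C : R, forall y, A y -> `|f y| <= C.

Definition unif_continuous_on (A : set R) (f : R -> R) :=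
  forall e : R, 0 < e -> exists2 d : R, 0 < d &
    forall y z, A y -> A z -> `|y - z| < d -> `|f y - f z| < e.

Definition msupport (V : topologicalType) (mu : set V -> \bar R) : set V :=
  [set x | forall U : set V, open U -> U x -> (0 < mu U)%E].

Definition monomial n (p : 'I_n -> nat) (u : 'rV[R]_n) : R :=
  \prod_i u 0 i ^+ p i.

(* Moments of order s are only required not to vanish all: asking each of them
   to be nonzero would exclude product kernels, e.g. because of u_1 u_2. *)
Definition kernel_of_order n (s : nat) (g : 'rV[R]_n -> R) :=
  [/\ forall p : 'I_n -> nat, (\sum_i p i <= s)%N ->
        (@lebesgue_rV R n).-integrable setT
          (EFin \o (fun u => monomial p u * g u)),
      \int[@lebesgue_rV R n]_u g u = 1,
      forall p : 'I_n -> nat, (0 < \sum_i p i < s)%N ->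
        \int[@lebesgue_rV R n]_u (monomial p u * g u) = 0 &
      exists2 p : 'I_n -> nat, (\sum_i p i = s)%N &
        \int[@lebesgue_rV R n]_u (monomial p u * g u) != 0].

Definition symmetric_kernel n (g : 'rV[R]_n -> R) := forall u, g (- u) = g u.

(* U_n = O_p(r_n). Passing to a measurable event avoids assuming U_n to be
   measurable. *)
Definition bounded_in_probability d (T : measurableType d)
    (P : probability T R) (U : nat -> T -> \bar R) (r : nat -> R) :=
  forall e : R, 0 < e -> exists M : R, \forall n \near \oo,
    exists A : set T, [/\ measurable A, ((1 - e)%:E <= P A)%E &
      forall w, A w -> (U n w <= (M * r n)%:E)%E].

Definition rho (tau u : R) : R := u * (tau - (u < 0)%R%:R).

End generic.

Section data.
Context {R : realType}.

(* Triples (Y(1), Y(0), D); the Boolean j stands for the treatment arm. *)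
Definition response := (R * R * bool)%type.
Definition pot (j : bool) (v : response) : R := if j then v.1.1 else v.1.2.
Definition trt (v : response) : bool := v.2.
Definition outcome (v : response) : R :=
  (trt v)%:R * pot true v + (1 - (trt v)%:R) * pot false v.

(* Z = (X, D, Y) *)
Definition observed k := ('rV[R]_k * bool * R)%type.
Definition observe k (z : 'rV[R]_k * response) : observed k :=
  (z.1, trt z.2, outcome z.2).

End data.
Arguments response : clear implicits.
Arguments observed : clear implicits.

(* The covariate X takes its values in R^k with k = l + m, and the subvector X_1
   consists of l arbitrarily chosen coordinates: the first l ones after the
   coordinates have been permuted by perm_X. Conditioning on the null event
   {X_1 = x_1} is only meaningful once versions have been fixed. These are the
   density dens_X of X, normalized to vanish off the support of X, and the
   regular conditional distribution cond_law of (Y(1), Y(0), D) given X. *)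
Record setting (R : realType) (l m : nat) d (T : measurableType d)
    (P : probability T R) := Setting {
  datum : {RV P >-> ('rV[R]_(l + m) * response R)%type};
  sample : nat -> {RV P >-> ('rV[R]_(l + m) * response R)%type};
  sample_ident : forall i A, measurable A ->
    P (sample i @^-1` A) = P (datum @^-1` A);
  sample_indep : forall n A, (forall i, measurable (A i)) ->
    fine (P (\bigcap_(i in `I_n) (sample i @^-1` A i))) =
    \prod_(i < n) fine (P (sample i @^-1` A i));
  perm_X : 'S_(l + m);
  dens_X : 'rV[R]_(l + m) -> R;
  dens_X_ge0 : forall x, 0 <= dens_X x;
  measurable_dens_X : measurable_fun setT dens_X;
  dens_X_supp : forall x, ~ msupport (pushforward P (fst \o datum)) x ->
    dens_X x = 0;
  cond_law : R.-pker 'rV[R]_(l + m) ~> response R;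
  datum_law : forall A, measurable A ->
    P (datum @^-1` A) = (\int[lebesgue_rV (l + m)]_x
      (cond_law x (xsection A x) * (dens_X x)%:E))%E
}.

Section conditioning.
Context {R : realType} {l m : nat} {d} {T : measurableType d}
  {P : probability T R}.
Variable S : setting l m P.
Notation k := (l + m)%N.
Notation datumT := ('rV[R]_k * response R)%type.

Definition sub_X (x : 'rV[R]_k) : 'rV[R]_l := lsubmx (col_perm (perm_X S) x).

(* The x with sub_X x = x1 and remaining coordinates x2. *)
Definition merge (x1 : 'rV[R]_l) (x2 : 'rV[R]_m) : 'rV[R]_k :=
  col_perm (perm_X S)^-1%g (row_mx x1 x2).

Lemma sub_X_merge x1 x2 : sub_X (merge x1 x2) = x1.
Proof. by rewrite /sub_X /merge -col_permM mulgV col_perm1 row_mxKl. Qed.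

Definition supp_X : set 'rV[R]_k :=
  msupport (pushforward P (fst \o datum S)).
Definition supp_X1 : set 'rV[R]_l :=
  msupport (pushforward P (sub_X \o fst \o datum S)).
Definition Omega : set 'rV[R]_l := interior supp_X1.

Definition dens_X1 (x1 : 'rV[R]_l) : R :=
  \int[lebesgue_rV m]_x2 dens_X S (merge x1 x2).

(* Conditional law of (X, (Y(1), Y(0), D)) given X_1 = x1: the other coordinates
   of X have conditional density dens_X (merge x1 x2) / dens_X1 x1. *)
Section cond_law1.
Variable x1 : 'rV[R]_l.

Definition cond_law1 (A : set datumT) : \bar R :=
  (\int[lebesgue_rV m]_x2
     (cond_law S (merge x1 x2) (xsection A (merge x1 x2)) *
      (dens_X S (merge x1 x2) / dens_X1 x1)%:E))%E.

Let w (x2 : 'rV[R]_m) := dens_X S (merge x1 x2) / dens_X1 x1.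

Let measurable_merge : measurable_fun setT (merge x1).
Proof.
apply: measurable_fun_rV => i; case: (split_ordP ((perm_X S)^-1%g i)) => j ij.
- rewrite (_ : _ \o _ = cst (x1 0 j)); first exact: measurable_cst.
  by apply/funext => x2 /=; rewrite /rV_coord !mxE ij (unsplitK (inl j)).
- rewrite (_ : _ \o _ = rV_coord j); first exact: measurable_rV_coord.
  by apply/funext => x2 /=; rewrite /rV_coord !mxE ij (unsplitK (inr j)).
Qed.

Let w_ge0 x2 : 0 <= w x2.
Proof.
apply: divr_ge0; first exact: dens_X_ge0.
by apply: Rintegral_ge0 => x _; exact: dens_X_ge0.
Qed.

Let measurable_w : measurable_fun setT w.
Proof.
apply: measurable_funM => //.
by apply: measurableT_comp => //; exact: measurable_dens_X.
Qed.

Let slice A (x2 : 'rV[R]_m) : \bar R :=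
  (cond_law S (merge x1 x2) (xsection A (merge x1 x2)) * (w x2)%:E)%E.

Let measurable_slice A : measurable A -> measurable_fun setT (slice A).
Proof.
move=> mA; apply: emeasurable_funM; last exact/measurable_EFinP.
have := measurable_fun_xsection_finite_kernel (cond_law S) (mem_set mA).
by move=> h; exact: (measurableT_comp h).
Qed.

Let law10 : cond_law1 set0 = 0%E.
Proof.
by rewrite /cond_law1 integral0_eq// => x2 _; rewrite xsection0 measure0 mul0e.
Qed.

Let law1_ge0 A : (0 <= cond_law1 A)%E.
Proof. by apply: integral_ge0 => x2 _; rewrite mule_ge0// lee_fin w_ge0. Qed.

Let law1_sigma_additive : semi_sigma_additive cond_law1.
Proof.
move=> F mF tF mUF.
rewrite [X in _ --> X](_ : _ = \sum_(n <oo) cond_law1 (F n))%E; last first.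
  rewrite /cond_law1 -integral_nneseries//; last 2 first.
  - by move=> n; exact: measurable_slice.
  - by move=> n x2 _; rewrite mule_ge0// lee_fin w_ge0.
  apply: eq_integral => x2 _.
  under eq_eseriesr do rewrite muleC.
  rewrite nneseriesZl//.
  rewrite muleC xsection_bigcup; congr (_ * _)%E.
  apply/esym/cvg_lim => //=.
  apply: (measure_sigma_additive _ (trivIset_xsection tF)) => n.
  exact: measurable_xsection.
by apply: is_cvg_nneseries => n _ _; exact: law1_ge0.
Qed.

HB.instance Definition _ := isMeasure.Build _ _ _ cond_law1
  law10 law1_ge0 law1_sigma_additive.

End cond_law1.

(* E[W | X = x] and E[W | X_1 = x1] for W a function of the whole datum. *)
Definition cond_E (x : 'rV[R]_k) (W : datumT -> R) : R :=
  \int[cond_law S x]_v W (x, v).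
Definition cond_E1 (x1 : 'rV[R]_l) (W : datumT -> R) : R :=
  \int[cond_law1 x1]_z W z.
Definition cond_Var (x : 'rV[R]_k) (W : datumT -> R) : R :=
  cond_E x (fun z => (W z - cond_E x W) ^+ 2).

Definition pscore (x : 'rV[R]_k) : R := cond_E x (fun z => (trt z.2)%:R).

(* F_j(y | x1) *)
Definition cond_cdf (j : bool) (x1 : 'rV[R]_l) (y : R) : R :=
  fine (cond_law1 x1 [set z | pot j z.2 <= y]).

Definition supp_Y (j : bool) (x1 : 'rV[R]_l) : set R :=
  msupport (fun B : set R => cond_law1 x1 [set z | B (pot j z.2)]).

(* fY j x1 is the density f_j(. | x1) of Y(j) given X_1 = x1. *)
Definition is_cond_density (fY : bool -> 'rV[R]_l -> R -> R) :=
  forall j x1, supp_X1 x1 ->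
    [/\ measurable_fun setT (fY j x1), forall y, 0 <= fY j x1 y &
      forall B : set R, measurable B ->
        cond_law1 x1 [set z | B (pot j z.2)] =
        (\int[lebesgue_measure]_(y in B) (fY j x1 y)%:E)%E].

Definition cond_risk (j : bool) (tau : R) (x1 : 'rV[R]_l) (a : R) : \bar R :=
  (\int[cond_law1 x1]_z (rho tau (pot j z.2 - a))%:E)%E.

(* q_{j,tau}(x1), as an argmin; the default value 0 is irrelevant once the
   minimizer exists. *)
Definition quant (j : bool) (tau : R) (x1 : 'rV[R]_l) : R :=
  xget 0 [set a | forall b, (cond_risk j tau x1 a <= cond_risk j tau x1 b)%E].

Definition is_cond_quantile (j : bool) (tau : R) (x1 : 'rV[R]_l) (a : R) :=
  (cond_law1 x1 [set z | pot j z.2 < a]%R <= tau%:E)%E /\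
  (tau%:E <= cond_law1 x1 [set z | pot j z.2 <= a]%R)%E.

Section variances.
Variables (fY : bool -> 'rV[R]_l -> R -> R) (tau : R) (x10 : 'rV[R]_l).

Definition quant_lin (j : bool) (x1 : 'rV[R]_l) : R :=
  quant j tau x10 + dot (gradient (quant j tau) x10) (x1 - x10).

Definition fYq (j : bool) : R := fY j x10 (quant j tau x10).

Definition eta (j : bool) (x1 : 'rV[R]_l) (y : R) : R :=
  ((y <= quant_lin j x1)%R%:R - tau) / fYq j.

Definition mj (j : bool) (x : 'rV[R]_k) : R :=
  cond_E x (fun z => (pot j z.2 <= quant_lin j (sub_X z.1))%R%:R - tau) / fYq j.

Definition psi (p : R) (z : observed R k) : R :=
  let: (x, t, y) := z in
  t%:R / p * eta true (sub_X x) y - (1 - t%:R) / (1 - p) * eta false (sub_X x) y.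

Definition eps (z : observed R k) : R := let: (x, t, _) := z in t%:R - pscore x.

Definition n_p (x : 'rV[R]_k) : R :=
  mj true x / pscore x + mj false x / (1 - pscore x).

Definition phi2 (z : observed R k) : R :=
  psi (pscore z.1.1) z - n_p z.1.1 * eps z.

Definition sigma2_pcqte : R :=
  cond_E1 x10 (fun z => psi (pscore z.1) (observe z) ^+ 2).

Definition sigma2_ncqte : R :=
  cond_E1 x10 (fun z => phi2 (observe z) ^+ 2).

Definition sigma2_tau (j : bool) (x : 'rV[R]_k) : R :=
  cond_Var x (fun z => ((pot j z.2 <= quant j tau x10)%R%:R - tau) / fYq j).

End variances.

(* Conditions on conditional laws given X = x are imposed at every x in the
   support, i.e. on the version cond_law. *)
Definition assumption1 :=
  (forall x, supp_X x -> forall (A : set (R * R)) (B : set bool),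
     measurable A -> measurable B ->
     cond_law S x (A `*` B) =
     (cond_law S x (A `*` setT) * cond_law S x (setT `*` B))%E) /\
  (exists2 c : R, 0 < c & forall x, supp_X x -> c < pscore x < 1 - c).

(* A density bounded away from zero on its support cannot be continuous on the
   whole line, whence the restrictions to supp_Y here and in assumption3. *)
Definition assumption2 (s1 : nat) (fY : bool -> 'rV[R]_l -> R -> R) :=
  (2 <= s1)%N /\
  forall (tau : R) (j : bool) (x10 : 'rV[R]_l), 0 < tau < 1 -> Omega x10 ->
  [/\ forall a, is_cond_quantile j tau x10 a <-> a = quant j tau x10,
      Cm s1 Omega (quant j tau),
      bounded_on setT (cond_cdf j x10) /\
      unif_continuous_on setT (cond_cdf j x10) &
      bounded_on (supp_Y j x10) (fY j x10) /\
      unif_continuous_on (supp_Y j x10) (fY j x10)].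

Definition assumption3 (s1 : nat) (fY : bool -> 'rV[R]_l -> R -> R) :=
  [/\ (2 <= s1)%N,
      exists a b : 'rV[R]_k, (forall i, a 0 i <= b 0 i) /\
        supp_X = [set x | forall i, a 0 i <= x 0 i <= b 0 i],
      bounded_away supp_X (dens_X S) /\ Cm_on s1 supp_X (dens_X S),
      bounded_away supp_X1 dens_X1 /\ Cm_on 1 supp_X1 dens_X1 &
      (exists c C : R, 0 < c /\ forall j x1 y, supp_X1 x1 -> supp_Y j x1 y ->
         c <= fY j x1 y <= C) /\
      (forall j x1, supp_X1 x1 ->
         Cm_on 1 (supp_Y j x1 : set (R^o : normedModType R)) (fY j x1))].

Definition assumption4 (s1 s sstar : nat) (K : 'rV[R]_l -> R) :=
  [/\ kernel_of_order s1 K, symmetric_kernel K, Cm sstar setT K,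
      (s <= sstar)%N & (k + l <= s)%N].

Definition assumption5 (s1 : nat) (h : nat -> R) :=
  [/\ forall n, 0 < h n, h n @[n --> \oo] --> (0 : R),
      n%:R * h n ^+ l @[n --> \oo] --> +oo &
      n%:R * h n ^+ (2 * s1 + l + 2) @[n --> \oo] --> (0 : R)].

Definition assumption6 (dim : nat) (Theta : set 'rV[R]_dim)
    (pi : 'rV[R]_k -> 'rV[R]_dim -> R) (beta0 : 'rV[R]_dim)
    (betahat : forall n, n.-tuple (observed R k) -> 'rV[R]_dim) :=
  [/\ Theta beta0,
      forall x, supp_X x -> pscore x = pi x beta0,
      forall n, measurable_fun setT (betahat n) /\
        forall zs, Theta (betahat n zs) &
      bounded_in_probability P
        (fun n w => ereal_sup
           [set `|pi x (betahat n [tuple observe (sample S i w) | i < n])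
                  - pi x beta0|%:E | x in supp_X])
        (fun n => (Num.sqrt n%:R)^-1)].

Definition assumption7 (s : nat) (L : 'rV[R]_k -> R) :=
  [/\ kernel_of_order s L /\ (k + l <= s)%N,
      symmetric_kernel L,
      exists2 M : R, 0 < M &
        forall u : 'rV[R]_k, ~ (forall i, `|u 0 i| <= M) -> L u = 0,
      Cm s.+1 setT L &
      Cm_on s supp_X (dens_X S) /\ bounded_away supp_X (dens_X S)].

Definition assumption8 (s : nat) (h0 : nat -> R) :=
  [/\ forall n, 0 < h0 n, h0 n @[n --> \oo] --> (0 : R) &
      ln n%:R / (n%:R * h0 n ^+ (k + s)) @[n --> \oo] --> (0 : R)].

Definition assumption9 (s : nat) (h h0 : nat -> R) :=
  h0 n ^+ (2 * s) / h n ^+ (2 * s + l) @[n --> \oo] --> (0 : R) /\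
  n%:R / h n ^+ l * h0 n ^+ (2 * s) @[n --> \oo] --> (0 : R).

End conditioning.

Arguments assumption4 {R} l m s1 s sstar K.
Arguments assumption5 {R} l s1 h.
Arguments assumption8 {R} l m s h0.
Arguments assumption9 {R} l s h h0.

(* Main.v *)
Require Import Defs.
From mathcomp Require Import all_boot all_order all_algebra perm.
From mathcomp Require Import all_classical all_reals all_analysis.
From mathcomp Require Import measurable_realfun ring.

Set Implicit Arguments.
Unset Strict Implicit.
Unset Printing Implicit Defensive.

Import Order.TTheory GRing.Theory Num.Theory.
Import numFieldNormedType.Exports.

Local Open Scope classical_set_scope.
Local Open Scope ring_scope.

(** Both variances are conditional second moments given X_1 = x10, and by the
tower property such a moment is the average, over the remaining covariates, of
the second moment given X = x. The whole content is therefore a computation of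
two moments given X = x, for x in the support with x_1 = x10.

Fix such an x, and write a_j for the centred indicator of arm j divided by the
density at the quantile, so that m_j = E[a_j | X = x]. At x_1 = x10 the linear
approximation of the quantile function is the quantile itself, hence
sigma2_j = Var(a_j | X = x). The outcome that is observed is the potential
outcome of the treatment received, so psi is a_1 / p on the treated and
- a_0 / (1 - p) on the untreated. Independence of D and the potential outcomes
given X then yields
  E[psi^2 | X = x] = E[a_1^2] / p + E[a_0^2] / (1 - p),
  E[psi eps | X = x] = (1 - p) m_1 + p m_0 = p (1 - p) n_p,
  E[eps^2 | X = x] = p (1 - p).
Thus n_p eps is the projection of psi on eps, and removing it lowers the second
moment by p (1 - p) n_p^2, which is the gap in the second claim; expanding
E[a_j^2] = sigma2_j + m_j^2 and completing the square gives the first claim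
([cond_E_phi2], [cond_E_psi]).

Since psi and phi2 depend on the response only through D and the indicator of
the arm that is observed, both moments are averages over four events whose
probabilities factor ([Rintegral_observed_arm]), and they become rational
functions of the propensity score and of two conditional distribution functions.

What remains is measure theory. The conditional law given X_1 = x10 is a mixture
of the laws given X = x ([ge0_integral_cond_law1]), and it charges only the x in
the support, where p is bounded away from 0 and 1. Nonnegative integrands that
are measurable, and bounded over these x, may hence be replaced by their
conditional expectations given X ([cond_E1_congr]) and their integrals may be
added. *)

(** * Mixtures of measures *)

Section mixture.
Context d1 d2 (Y : measurableType d1) (Z : measurableType d2) (R : realType).
Variables (mu : {measure set Y -> \bar R}) (k : Y -> {measure set Z -> \bar R})
  (nu : {measure set Z -> \bar R}).
Hypothesis mk : forall A, measurable A -> measurable_fun setT (k ^~ A).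
Hypothesis nuE : forall A, measurable A -> nu A = (\int[mu]_y k y A)%E.

Import HBNNSimple.

Lemma integral_mixture_nnsfun (g : {nnsfun Z >-> R}) :
  (\int[nu]_z (g z)%:E = \int[mu]_y \int[k y]_z (g z)%:E)%E.
Proof.
have mg r : measurable (g @^-1` [set r]) by [].
rewrite integralT_nnsfun sintegralE.
under [RHS]eq_integral do rewrite integralT_nnsfun sintegralE.
rewrite ge0_integral_fsum//.
- apply: eq_fsbigr => r; rewrite inE => -[z _ <-].
  rewrite nuE// ge0_integralZl// ?lee_fin//; exact: mk.
- by move=> r; apply: measurable_funeM; exact: mk.
- move=> r y _; have [r0|r0] := leP 0 r; first by rewrite mule_ge0.
  by rewrite preimage_nnfun0// measure0 mule0.
Qed.

(** Both sides commute with increasing limits, so that simple functions suffice;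
for these the identity is linearity. *)
Lemma ge0_integral_mixture (f : Z -> \bar R) : (forall z, 0 <= f z)%E ->
  measurable_fun setT f ->
  (\int[nu]_z f z = \int[mu]_y \int[k y]_z f z)%E.
Proof.
move=> f0 mf; pose g := nnsfun_approx measurableT mf.
have ndg z : nondecreasing_seq (fun n => (g n z)%:E).
  by move=> a b ab; rewrite lee_fin; exact/lefP/nd_nnsfun_approx.
have fE z : f z = limn (fun n => (g n z)%:E).
  by apply/esym/cvg_lim => //; exact: cvg_nnsfun_approx.
have mcE (lam : {measure set Z -> \bar R}) :
    (\int[lam]_z f z = limn (fun n => \int[lam]_z (g n z)%:E))%E.
  under [LHS]eq_integral do rewrite fE.
  rewrite monotone_convergence//.
  - by move=> n; exact/measurable_EFinP.
  - by move=> n z _; rewrite lee_fin.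
rewrite mcE; under eq_fun do rewrite integral_mixture_nnsfun.
under [RHS]eq_integral do rewrite mcE.
rewrite monotone_convergence//.
- move=> n; apply: measurable_fun_integral_kernel => //.
    by move=> z; rewrite lee_fin.
  exact/measurable_EFinP.
- by move=> n y _; apply: integral_ge0 => z _; rewrite lee_fin.
- move=> y _ a b ab; apply: ge0_le_integral => //.
  + by move=> z _; rewrite lee_fin.
  + exact/measurable_EFinP.
  + exact/measurable_EFinP.
  + by move=> z _; exact: ndg.
Qed.

End mixture.

(** * Disintegration of the law given X_1 along X *)

Section disintegration.
Context {R : realType} {l m : nat} {d} {T : measurableType d}
  {P : probability T R}.
Variable S : setting l m P.
Local Notation k := (l + m)%N.
Local Notation datumT := ('rV[R]_k * response R)%type.

Lemma measurable_merge (x1 : 'rV[R]_l) : measurable_fun setT (Defs.merge S x1).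
Proof.
apply: measurable_fun_rV => i; case: (split_ordP ((perm_X S)^-1%g i)) => j ij.
- rewrite (_ : _ \o _ = cst (x1 0 j)); first exact: measurable_cst.
  by apply/funext => x2 /=; rewrite /rV_coord !mxE ij (unsplitK (inl j)).
- rewrite (_ : _ \o _ = rV_coord j); first exact: measurable_rV_coord.
  by apply/funext => x2 /=; rewrite /rV_coord !mxE ij (unsplitK (inr j)).
Qed.

Variable x1 : 'rV[R]_l.

(** The conditional density, given X_1 = x1, of the covariates outside X_1. *)
Definition cond_weight (x2 : 'rV[R]_m) : R :=
  dens_X S (Defs.merge S x1 x2) / dens_X1 S x1.

Lemma cond_weight_ge0 x2 : 0 <= cond_weight x2.
Proof.
apply: divr_ge0; first exact: dens_X_ge0.
by apply: Rintegral_ge0 => x _; exact: dens_X_ge0.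
Qed.

Lemma measurable_cond_weight : measurable_fun setT cond_weight.
Proof.
apply: measurable_funM => //.
by apply: measurableT_comp (measurable_merge x1); exact: measurable_dens_X.
Qed.

(** Given X_1 = x1, the datum is drawn in two steps: the remaining covariates from
[cond_weight], then the response from [cond_law] at the completed covariate
vector. Integrals against the resulting law are iterated integrals. *)
Lemma ge0_integral_cond_law1 (f : datumT -> \bar R) :
  (forall z, 0 <= f z)%E -> measurable_fun setT f ->
  (\int[cond_law1 S x1]_z f z =
   \int[lebesgue_rV m]_x2
     (\int[cond_law S (Defs.merge S x1 x2)]_v f (Defs.merge S x1 x2, v) *
      (cond_weight x2)%:E))%E.
Proof.
move=> f0 mf.
have mp (x2 : 'rV[R]_m) :=
  @pair1_measurable _ _ _ (response R) (Defs.merge S x1 x2).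
pose K (x2 : 'rV[R]_m) : {measure set datumT -> \bar R} :=
  mscale (NngNum (cond_weight_ge0 x2))
    (pushforward (cond_law S (Defs.merge S x1 x2)) (pair (Defs.merge S x1 x2))).
have KE (x2 : 'rV[R]_m) (A : set datumT) : K mp x2 A =
    (cond_law S (Defs.merge S x1 x2) (xsection A (Defs.merge S x1 x2)) *
     (cond_weight x2)%:E)%E.
  by rewrite xsectionE muleC.
have mK A : measurable A -> measurable_fun setT (fun x2 => K mp x2 A).
  move=> mA.
  have := measurable_fun_xsection_finite_kernel (cond_law S) (mem_set mA).
  move=> /measurableT_comp /(_ (measurable_merge x1)) mx.
  have := emeasurable_funM mx
    (measurableT_comp (@EFin_measurable _ _) measurable_cond_weight).
  by apply: eq_measurable_fun => x2 _; rewrite KE.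
rewrite (ge0_integral_mixture (mu := lebesgue_rV m) mK)//; last first.
  by move=> A mA; rewrite /= /cond_law1; apply: eq_integral => x2 _; rewrite KE.
apply: eq_integral => x2 _.
rewrite ge0_integral_mscale// muleC; congr (_ * _)%E.
by rewrite ge0_integral_pushforward.
Qed.

(** The covariate values that the law given X_1 = x1 charges. Membership in the
support is part of it because the conditions on conditional laws given X hold
only there. *)
Definition fibre : set 'rV[R]_k := [set x | supp_X S x /\ sub_X S x = x1].

(** The chosen version of the density of X vanishes off the support, so that
covariate values outside the support receive no weight. *)
Lemma merge_fibre x2 : cond_weight x2 != 0 -> fibre (Defs.merge S x1 x2).
Proof.
move=> w0; split; last exact: sub_X_merge.
apply: contrapT => /dens_X_supp d0.
by move: w0; rewrite /cond_weight d0 mul0r eqxx.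
Qed.

Hypothesis dens_gt0 : 0 < dens_X1 S x1.

Lemma integral_cond_weight :
  (\int[lebesgue_rV m]_x2 (cond_weight x2)%:E = 1)%E.
Proof.
have md : measurable_fun setT (fun x2 => (dens_X S (Defs.merge S x1 x2))%:E).
  apply/measurable_EFinP.
  by apply: measurableT_comp (measurable_merge x1); exact: measurable_dens_X.
have int_dens : (\int[lebesgue_rV m]_x2 (dens_X S (Defs.merge S x1 x2))%:E =
    (dens_X1 S x1)%:E)%E.
  (* An infinite integral would be turned by [fine] into dens_X1 = 0. *)
  rewrite /dens_X1 /Rintegral fineK//.
  move: dens_gt0; rewrite /dens_X1 /Rintegral.
  by case: (integral _ _ _) => //=; rewrite ltxx.
under eq_integral do rewrite EFinM.
rewrite ge0_integralZr//.
- by rewrite int_dens -EFinM divff// gt_eqF.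
- by move=> x2 _; rewrite lee_fin dens_X_ge0.
- by rewrite lee_fin invr_ge0 ltW.
Qed.

(** Uniform bounds can only be asked on the fibre: 1 / p and 1 / (1 - p) are
controlled there but not elsewhere. *)
Definition bounded_on_fibre (W : datumT -> R) :=
  exists C : R, forall x v, fibre x -> `|W (x, v)| <= C.

Lemma integrable_cond_law1 (W : datumT -> R) :
  measurable_fun setT W -> bounded_on_fibre W ->
  (cond_law1 S x1).-integrable setT (EFin \o W).
Proof.
move=> mW [C WC]; apply/integrableP; split; first exact/measurable_EFinP.
rewrite /= ge0_integral_cond_law1//; last first.
  by apply/measurable_EFinP; exact: measurableT_comp.
apply: (@le_lt_trans _ _ (`|C|%:E)%E); last exact: ltry.
have mW' : measurable_fun setT (fun z => `|W z|%:E).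
  by apply/measurable_EFinP; exact: measurableT_comp.
have W0 z : (0 <= `|W z|%:E)%E by rewrite lee_fin.
have mh := measurable_fun_integral_finite_kernel _ (cond_law S) W0 mW'.
rewrite -[leRHS]mule1 -integral_cond_weight -ge0_integralZl//; last 2 first.
- apply/measurable_EFinP; exact: measurable_cond_weight.
- by move=> x2 _; rewrite lee_fin cond_weight_ge0.
apply: ge0_le_integral => //.
- move=> x2 _; apply: mule_ge0; last by rewrite lee_fin cond_weight_ge0.
  by apply: integral_ge0.
- apply: emeasurable_funM; last first.
    by apply/measurable_EFinP; exact: measurable_cond_weight.
  exact: (measurableT_comp mh (measurable_merge x1)).
- by apply: measurable_funeM; apply/measurable_EFinP; exact: measurable_cond_weight.
- move=> x2 _; have [->|w0] := eqVneq (cond_weight x2) 0; first by rewrite !mule0.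
  have fx := merge_fibre w0.
  apply: lee_pmul => //; first exact: integral_ge0.
    by rewrite lee_fin cond_weight_ge0.
  apply: (@le_trans _ _
    (\int[cond_law S (Defs.merge S x1 x2)]_v cst `|C|%:E v)%E).
    apply: ge0_le_integral => //.
    + exact: measurableT_comp mW' (pair1_measurable _).
    + by move=> v _; rewrite lee_fin (le_trans (WC _ _ fx))// ler_norm.
  by rewrite integral_cst// prob_kernel mule1.
Qed.

(** A form of the tower property: the conditional expectation given X_1 depends
on an integrand only through its conditional expectations given X. The bounds
make the inner integrals finite; the real-valued integral would replace an
infinite one by 0 and break the comparison. *)
Lemma cond_E1_congr (W V : datumT -> R) :
  (forall z, 0 <= W z) -> (forall z, 0 <= V z) ->
  measurable_fun setT W -> measurable_fun setT V ->
  bounded_on_fibre W -> bounded_on_fibre V ->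
  (forall x, fibre x -> cond_E S x W = cond_E S x V) ->
  cond_E1 S x1 W = cond_E1 S x1 V.
Proof.
move=> W0 V0 mW mV [C WC] [D VD] WV; congr fine.
rewrite !ge0_integral_cond_law1//; last 2 first.
- exact/measurable_EFinP.
- exact/measurable_EFinP.
apply: eq_integral => x2 _.
have [->|w0] := eqVneq (cond_weight x2) 0; first by rewrite !mule0.
have fx := merge_fibre w0.
have fin_int (U : datumT -> R) (B : R) : measurable_fun setT U ->
    (forall x v, fibre x -> `|U (x, v)| <= B) ->
    (\int[cond_law S (Defs.merge S x1 x2)]_v (U (Defs.merge S x1 x2, v))%:E
      \is a fin_num)%E.
  move=> mU UB; apply: integrable_fin_num => //.
  apply: measurable_bounded_integrable => //.
  - by rewrite prob_kernel ltry.
  - exact: measurableT_comp mU (pair1_measurable _).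
  - exists B; split; first exact: num_real.
    by move=> B' BB' v _ /=; rewrite (le_trans (UB _ _ fx))// ltW.
rewrite -[X in (X * _)%E]fineK ?(fin_int _ C)//.
rewrite -[X in _ = (X * _)%E]fineK ?(fin_int _ D)//.
by congr (_%:E * _)%E; exact: WV.
Qed.

End disintegration.

(** * Finitely valued random variables *)

Section probability_measure.
Context d (T : measurableType d) (R : realType).
Variable Q : {measure set T -> \bar R}.
Hypothesis Q1 : (Q setT = 1)%E.

Lemma prob_fin_num A : measurable A -> Q A \is a fin_num.
Proof.
move=> mA; rewrite ge0_fin_numE//.
apply: (@le_lt_trans _ _ 1%E); last exact: ltry.
by rewrite -Q1; apply: le_measure => //; rewrite inE.
Qed.

Lemma Rintegral_finite_range (I : finType) (b : T -> I) (c : I -> R) :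
  (forall i, measurable (b @^-1` [set i])) ->
  \int[Q]_v c (b v) = \sum_i c i * fine (Q (b @^-1` [set i])).
Proof.
move=> mb; have cE v : c (b v) = \sum_i c i * \1_(b @^-1` [set i]) v.
  rewrite (bigD1 (b v))//= big1 ?addr0; last first.
    by move=> i ib; rewrite indicE memNset ?mulr0//= => /esym/eqP;
      rewrite (negbTE ib).
  by rewrite indicE mem_set ?mulr1.
have int_indic i : Q.-integrable setT (EFin \o (\1_(b @^-1` [set i]) : T -> R)).
  apply: measurable_bounded_integrable => //.
  - by rewrite Q1 ltry.
  - exists 1; split=> [|x x1 v _]; first exact: num_real.
    by rewrite /= ger0_norm// (le_trans _ (ltW x1))// indicE lern1 leq_b1.
rewrite /Rintegral; under eq_integral do rewrite cE -sumEFin.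
rewrite integral_sum//; last first.
  move=> i; under [X in _.-integrable _ X]eq_fun do rewrite EFinM.
  by apply: integrableZl => //; exact: int_indic.
have int_c i : (\int[Q]_v (c i * \1_(b @^-1` [set i]) v)%:E =
    (c i * fine (Q (b @^-1` [set i])))%:E)%E.
  under eq_integral do rewrite EFinM.
  rewrite (integralZl _ (int_indic i))// (integral_indic _ measurableT)// setIT.
  by rewrite -[in LHS](fineK (prob_fin_num (mb i))).
by under eq_bigr do rewrite int_c; rewrite sumEFin.
Qed.

Lemma preimage_false (b : T -> bool) :
  b @^-1` [set false] = ~` (b @^-1` [set true]).
Proof. by apply/seteqP; split => v /=; case: (b v). Qed.

Lemma prob_bool_preimage (b : T -> bool) (s : bool) :
  measurable (b @^-1` [set true]) ->
  fine (Q (b @^-1` [set s])) =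
  if s then fine (Q (b @^-1` [set true]))
  else 1 - fine (Q (b @^-1` [set true])).
Proof.
case: s => // mb; rewrite preimage_false.
rewrite -setTD measureD//; last by rewrite [ltLHS]Q1 ltry.
by rewrite setTI [X in fine (X - _)%E]Q1 fineB// prob_fin_num.
Qed.

Lemma Rintegral_bool (b : T -> bool) (c : bool -> R) :
  measurable (b @^-1` [set true]) ->
  let F := fine (Q (b @^-1` [set true])) in
  \int[Q]_v c (b v) = F * c true + (1 - F) * c false.
Proof.
move=> mb F; have mbs (s : bool) : measurable (b @^-1` [set s]).
  by case: s => //; rewrite preimage_false; exact: measurableC.
rewrite (Rintegral_finite_range c mbs) big_bool /= (prob_bool_preimage false mb).
by rewrite mulrC [X in _ + X]mulrC.
Qed.

Lemma fine_prob_itv A : measurable A -> 0 <= fine (Q A) <= 1.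
Proof.
move=> mA; rewrite fine_ge0//= -lee_fin fineK ?prob_fin_num// -Q1.
by apply: le_measure => //; rewrite inE.
Qed.

End probability_measure.

(** * Expectations over the observed arm *)

Section responses.
Context {R : realType}.

Lemma measurable_pot (j : bool) :
  measurable_fun setT (pot j : response R -> R).
Proof.
by case: j; [exact: (measurableT_comp measurable_fst measurable_fst)
            |exact: (measurableT_comp measurable_snd measurable_fst)].
Qed.

Lemma measurable_trt : measurable_fun setT (trt : response R -> bool).
Proof. exact: measurable_snd. Qed.

Lemma measurable_le_event d (T : measurableType d) (f g : T -> R) :
  measurable_fun setT f -> measurable_fun setT g ->
  measurable [set x | f x <= g x].
Proof.
by move=> mf mg; rewrite -[X in measurable X]setTI; exact: measurable_fun_le.
Qed.

Lemma measurable_pot_le (j : bool) (a : R) :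
  measurable [set v : response R | pot j v <= a].
Proof. by apply: measurable_le_event => //; exact: measurable_pot. Qed.

Variable Q : {measure set (response R) -> \bar R}.
Hypothesis Q1 : (Q setT = 1)%E.
Hypothesis indep : forall (A : set (R * R)) (B : set bool),
  measurable A -> measurable B ->
  Q (A `*` B) = (Q (A `*` setT) * Q (setT `*` B))%E.

(** Only the potential outcome of the arm that is taken enters, so the pair of D
and the indicator of Y(D) <= a_D takes each of its four values on a rectangle
event, whose probability factors by independence. *)
Lemma Rintegral_observed_arm (a : bool -> R) (c : bool -> bool -> R) :
  let p := fine (Q (trt @^-1` [set true])) in
  let F j := fine (Q [set v | pot j v <= a j]) in
  \int[Q]_v c (trt v) (pot (trt v) v <= a (trt v)) =
    p * (F true * c true true + (1 - F true) * c true false) +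
    (1 - p) * (F false * c false true + (1 - F false) * c false false).
Proof.
move=> p F.
pose b (v : response R) := (trt v, pot (trt v) v <= a (trt v)).
pose below j (y : R * R) := (if j then y.1 else y.2) <= a j.
have mbelow j s : measurable (below j @^-1` [set s]).
  suff mj : measurable_fun setT (below j).
    by rewrite -[X in measurable X]setTI; exact: mj.
  apply: measurable_fun_ler => //.
  by case: j; [exact: measurable_fst|exact: measurable_snd].
have bE t s : b @^-1` [set (t, s)] = (below t @^-1` [set s]) `*` [set t].
  apply/seteqP; split => -[[y1 y0] j].
    by move=> [<- <-]; case: j.
  by rewrite /b /below /= => -[/= <- <-]; case: j.
have armE t s : (below t @^-1` [set s]) `*` [set: bool] =
    (fun v => pot t v <= a t) @^-1` [set s].
  by apply/seteqP; split => -[[y1 y0] j] /=; case: t => // -[].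
have trtE t : [set: R * R] `*` [set t] = trt @^-1` [set t].
  by apply/seteqP; split => -[y j] //= -[].
rewrite (Rintegral_finite_range Q1 (b := b) (fun i => c i.1 i.2)); last first.
  by case=> t s; rewrite bE; exact: measurableX.
have Qb t s : fine (Q (b @^-1` [set (t, s)])) =
    (if t then p else 1 - p) * (if s then F t else 1 - F t).
  rewrite bE indep// armE trtE fineM; last 2 first.
  - by apply: prob_fin_num => //; rewrite -armE; exact: measurableX.
  - by apply: prob_fin_num => //; rewrite -trtE; exact: measurableX.
  rewrite mulrC; congr (_ * _).
    by rewrite (prob_bool_preimage Q1)// -trtE; exact: measurableX.
  by rewrite (prob_bool_preimage Q1)// -armE; exact: measurableX.
rewrite (eq_bigr (fun i => c i.1 i.2 * fine (Q (b @^-1` [set (i.1, i.2)]))));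
  last by case.
rewrite -(pair_bigA _ (fun t s => c t s * fine (Q (b @^-1` [set (t, s)])))) /=.
rewrite !big_bool/= !Qb.
by ring.
Qed.

End responses.

(** * Moments given X *)

Section conditional_moments.
Context {R : realType} {l m : nat} {d} {T : measurableType d}
  {P : probability T R}.
Variable S : setting l m P.
Local Notation k := (l + m)%N.

(** The distribution function of Y(j) given the whole of X, as opposed to
[cond_cdf], which conditions on X_1. *)
Definition arm_cdf (j : bool) (x : 'rV[R]_k) (a : R) : R :=
  fine (cond_law S x [set v | pot j v <= a]).

Lemma arm_cdf_itv j x a : 0 <= arm_cdf j x a <= 1.
Proof. by apply: fine_prob_itv; [exact: prob_kernel|exact: measurable_pot_le]. Qed.

Lemma pscoreE x : pscore S x = fine (cond_law S x (trt @^-1` [set true])).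
Proof.
rewrite /pscore /cond_E (Rintegral_bool (prob_kernel x) (fun s => s%:R)).
  by rewrite mulr1 mulr0 addr0.
by rewrite -[X in measurable X]setTI; exact: measurable_trt.
Qed.

Lemma cond_E_cst x (g : 'rV[R]_k -> R) : cond_E S x (fun z => g z.1) = g x.
Proof. by rewrite /cond_E /= (Rintegral_cst _ measurableT) prob_kernel mulr1. Qed.

Lemma cond_E_arm x j (a : R) (c : bool -> R) :
  cond_E S x (fun z => c (pot j z.2 <= a)) =
  arm_cdf j x a * c true + (1 - arm_cdf j x a) * c false.
Proof.
rewrite /cond_E (Rintegral_bool (prob_kernel x) (b := fun v => pot j v <= a))//.
exact: measurable_pot_le.
Qed.

Variables (fY : bool -> 'rV[R]_l -> R -> R) (tau : R) (x10 : 'rV[R]_l).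
Local Notation qlin j x := (quant_lin S tau x10 j (sub_X S x)).
Local Notation f := (fYq S fY tau x10).

Lemma mjE j x : mj S fY tau x10 j x = (arm_cdf j x (qlin j x) - tau) / f j.
Proof.
rewrite /mj; congr (_ / _).
rewrite (_ : cond_E _ _ _ =
  cond_E S x (fun z => (pot j z.2 <= qlin j x)%R%:R - tau))//.
rewrite (cond_E_arm _ _ _ (fun s => s%:R - tau)).
by rewrite /=; ring.
Qed.

(** The variance of a Bernoulli variable, rescaled. *)
Lemma sigma2_tauE j x : sigma2_tau S fY tau x10 j x =
  let F := arm_cdf j x (quant S j tau x10) in F * (1 - F) / f j ^+ 2.
Proof.
rewrite /sigma2_tau /cond_Var /=.
rewrite (cond_E_arm _ _ _ (fun s => (s%:R - tau) / f j)).
set F := arm_cdf _ _ _; set e := F * _ + _.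
rewrite (cond_E_arm _ _ _ (fun s => ((s%:R - tau) / f j - e) ^+ 2)) -/F.
rewrite /e -/F /= -exprVn !expr2; set y := (f j)^-1.
by ring.
Qed.

(** D and 1 - D select the term of the arm that is taken, and in that term the
observed outcome is the potential outcome. *)
Lemma psi_armE x v : psi S fY tau x10 (pscore S x) (observe (x, v)) =
  (if trt v then (pscore S x)^-1 else - (1 - pscore S x)^-1) *
  (((pot (trt v) v <= qlin (trt v) x)%R%:R - tau) / f (trt v)).
Proof.
case: v => -[y1 y0] t; rewrite /psi /= /eta /outcome /=.
case: t => /=; rewrite ?(subrr, subr0, mul0r, mul1r, addr0, add0r, mulr0n, mulr1n)//.
by rewrite mulNr.
Qed.

Lemma phi2_armE x v : phi2 S fY tau x10 (observe (x, v)) =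
  (if trt v then (pscore S x)^-1 else - (1 - pscore S x)^-1) *
  (((pot (trt v) v <= qlin (trt v) x)%R%:R - tau) / f (trt v)) -
  n_p S fY tau x10 x * ((trt v)%:R - pscore S x).
Proof. by rewrite -psi_armE. Qed.

(** The linearization is anchored at x10. This reconciles [mj], which uses the
linearized quantile, with [sigma2_tau], which uses the quantile at x10. *)
Lemma fibre_quant_lin j x : fibre S x10 x -> qlin j x = quant S j tau x10.
Proof.
move=> [_ ->]; rewrite /quant_lin /dot subrr big1 ?addr0// => i _.
by rewrite [X in _ * X]mxE mulr0.
Qed.

Hypothesis A1 : assumption1 S.

Lemma pscore_bounds x : fibre S x10 x -> 0 < pscore S x < 1.
Proof.
move=> [sx _]; have [c c0 /(_ x sx)/andP[cp p1]] := A1.2.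
by rewrite (lt_trans c0 cp) (lt_trans p1)// gtrBl.
Qed.

Lemma cond_E_observed_arm x (c : bool -> bool -> R) : fibre S x10 x ->
  let p := pscore S x in
  let F j := arm_cdf j x (quant S j tau x10) in
  cond_E S x (fun z => c (trt z.2) (pot (trt z.2) z.2 <= qlin (trt z.2) x)) =
    p * (F true * c true true + (1 - F true) * c true false) +
    (1 - p) * (F false * c false true + (1 - F false) * c false false).
Proof.
move=> fx p F; rewrite /cond_E /= /p pscoreE.
rewrite (Rintegral_observed_arm (prob_kernel x) _ (fun j => qlin j x) c).
  by rewrite !fibre_quant_lin.
by move=> A B mA mB; apply: A1.1 => //; case: fx.
Qed.

Local Notation p x := (pscore S x).
Local Notation mm j x := (mj S fY tau x10 j x).
Local Notation ss j x := (sigma2_tau S fY tau x10 j x).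

(** With the four probabilities inserted, both sides are rational functions of p
and of the two values of [arm_cdf]. The squared means combine because
m_1^2 / p + m_0^2 / (1 - p) - p (1 - p) n_p^2 = (m_1 - m_0)^2. *)
Lemma cond_E_phi2 x : fibre S x10 x ->
  cond_E S x (fun z => phi2 S fY tau x10 (observe z) ^+ 2) =
  (mm true x - mm false x) ^+ 2 + ss true x / p x + ss false x / (1 - p x).
Proof.
move=> fx; have /andP[p0 p1] := pscore_bounds fx.
pose c (t s : bool) :=
    ((if t then (p x)^-1 else - (1 - p x)^-1) * ((s%:R - tau) / f t) -
     n_p S fY tau x10 x * (t%:R - p x)) ^+ 2.
transitivity (cond_E S x (fun z =>
    c (trt z.2) (pot (trt z.2) z.2 <= qlin (trt z.2) x))).
  by apply: eq_Rintegral => v _; rewrite phi2_armE.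
rewrite cond_E_observed_arm// /c /n_p !mjE !sigma2_tauE !fibre_quant_lin//=.
(* The inverse densities enter polynomially; only p and 1 - p stay in the
   denominators. *)
rewrite -!exprVn; move: (f true)^-1 (f false)^-1 => y1 y0.
by field; rewrite !gt_eqF// subr_gt0.
Qed.

(** The additional term is the second moment p (1 - p) n_p^2 of the projection of
psi on eps. *)
Lemma cond_E_psi x : fibre S x10 x ->
  cond_E S x (fun z => psi S fY tau x10 (p z.1) (observe z) ^+ 2) =
  (mm true x - mm false x) ^+ 2 + ss true x / p x + ss false x / (1 - p x) +
  p x * (1 - p x) * (mm true x / p x + mm false x / (1 - p x)) ^+ 2.
Proof.
move=> fx; have /andP[p0 p1] := pscore_bounds fx.
pose c (t s : bool) :=
    ((if t then (p x)^-1 else - (1 - p x)^-1) * ((s%:R - tau) / f t)) ^+ 2.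
transitivity (cond_E S x (fun z =>
    c (trt z.2) (pot (trt z.2) z.2 <= qlin (trt z.2) x))).
  by apply: eq_Rintegral => v _; rewrite psi_armE.
rewrite cond_E_observed_arm// /c !mjE !sigma2_tauE !fibre_quant_lin//=.
rewrite -!exprVn; move: (f true)^-1 (f false)^-1 => y1 y0.
by field; rewrite !gt_eqF// subr_gt0.
Qed.

End conditional_moments.

(** * Measurability and bounds *)

Lemma measurable_invr (R : realType) :
  measurable_fun setT (@GRing.inv R : R -> R).
Proof.
have m0 : measurable [set (0 : R)] by [].
rewrite -(setvU [set (0 : R)]); apply/measurable_funU => //.
  exact: measurableC.
split; last exact: measurable_fun_set1.
apply: open_continuous_measurable_fun.
  apply/closed_openC/accessible_closed_set1/hausdorff_accessible.
  exact: norm_hausdorff.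
by move=> x /[!inE] /= /eqP x0; exact: inv_continuous.
Qed.

Section regularity.
Context {R : realType} {l m : nat} {d} {T : measurableType d}
  {P : probability T R}.
Variable S : setting l m P.
Local Notation k := (l + m)%N.
Local Notation datumT := ('rV[R]_k * response R)%type.
Variables (fY : bool -> 'rV[R]_l -> R -> R) (tau : R) (x10 : 'rV[R]_l).

(** The regularity needed for [cond_E1_congr] and [integrable_cond_law1]. Tame
functions form an algebra that contains the indicators, p, 1 / p and
1 / (1 - p), hence all the integrands that occur. *)
Definition tame (W : datumT -> R) :=
  measurable_fun setT W /\ bounded_on_fibre S x10 W.

Lemma tame_cst c : tame (fun=> c).
Proof. by split; [exact: measurable_cst|exists `|c|]. Qed.

Lemma tameD W V : tame W -> tame V -> tame (fun z => W z + V z).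
Proof.
move=> [mW [C WC]] [mV [D VD]]; split; first exact: measurable_funD.
by exists (C + D) => x v fx; rewrite (le_trans (ler_normD _ _))// lerD ?WC ?VD.
Qed.

Lemma tameM W V : tame W -> tame V -> tame (fun z => W z * V z).
Proof.
move=> [mW [C WC]] [mV [D VD]]; split; first exact: measurable_funM.
by exists (C * D) => x v fx; rewrite normrM ler_pM ?WC ?VD.
Qed.

Lemma tameN W : tame W -> tame (fun z => - W z).
Proof.
move=> tW; rewrite (_ : (fun _ => _) = fun z => -1 * W z).
  exact: (tameM (tame_cst _)).
by apply/funext => z; rewrite mulN1r.
Qed.

Lemma tameB W V : tame W -> tame V -> tame (fun z => W z - V z).
Proof. by move=> tW tV; apply: tameD => //; exact: tameN. Qed.

Lemma tame_sqr W : tame W -> tame (fun z => W z ^+ 2).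
Proof. by move=> tW; exact: tameM. Qed.

Lemma tame_bool (b : datumT -> bool) :
  measurable_fun setT b -> tame (fun z => (b z)%:R).
Proof.
move=> mb; split; last by exists 1 => x v _; rewrite normr_nat lern1 leq_b1.
rewrite (_ : (fun _ => _) = fun z => if b z then 1 else 0).
  by apply: measurable_fun_ifT => //; exact: measurable_cst.
by apply/funext => z; case: (b z).
Qed.

Lemma measurable_sub_X : measurable_fun setT (sub_X S).
Proof.
apply: measurable_fun_rV => i.
rewrite (_ : _ \o _ = rV_coord (perm_X S (lshift m i))).
  exact: measurable_rV_coord.
by apply/funext => x; rewrite /rV_coord /= /sub_X !mxE.
Qed.

Lemma measurable_quant_lin j :
  measurable_fun setT (fun x => quant_lin S tau x10 j (sub_X S x)).
Proof.
apply: measurable_funD => //; apply: measurable_sum => i.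
apply: measurable_funM => //.
rewrite (_ : (fun _ => _) = fun x => rV_coord i (sub_X S x) - x10 0 i).
  apply: measurable_funB => //.
  exact: (measurableT_comp (measurable_rV_coord i) measurable_sub_X).
by apply/funext => x; rewrite /rV_coord !mxE.
Qed.

Lemma measurable_outcome : measurable_fun setT (@outcome R).
Proof.
rewrite (_ : @outcome R = fun v => if trt v then pot true v else pot false v).
  by apply: measurable_fun_ifT;
    [exact: measurable_trt|exact: measurable_pot|exact: measurable_pot].
apply/funext => -[[y1 y0] t]; rewrite /outcome /=.
by case: t; rewrite ?(mul1r, subrr, mul0r, subr0, addr0, add0r).
Qed.

(** The event Y(j) <= g(X) is a measurable set of data, and a kernel evaluated at
the sections of such a set is measurable in the base point. *)
Lemma measurable_arm_cdf j (g : 'rV[R]_k -> R) : measurable_fun setT g ->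
  measurable_fun setT (fun x => arm_cdf S j x (g x)).
Proof.
move=> mg.
pose A := [set z : datumT | pot j z.2 <= g z.1].
have mA : measurable A.
  apply: measurable_le_event.
    exact: measurableT_comp (measurable_pot j) measurable_snd.
  exact: measurableT_comp mg measurable_fst.
have := measurable_fun_xsection_finite_kernel (cond_law S) (mem_set mA).
move=> /(measurableT_comp (fine_measurable measurableT)).
apply: eq_measurable_fun => x _ /=; rewrite /arm_cdf.
by congr (fine (cond_law S x _)); rewrite xsectionE.
Qed.

Lemma tame_arm_cdf j (g : 'rV[R]_k -> R) : measurable_fun setT g ->
  tame (fun z => arm_cdf S j z.1 (g z.1)).
Proof.
move=> mg; split.
  exact: (measurableT_comp (measurable_arm_cdf j mg) measurable_fst).
exists 1 => x v _ /=; have /andP[F0 F1] := arm_cdf_itv S j x (g x).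
by rewrite ger0_norm.
Qed.

Lemma measurable_pscore : measurable_fun setT (pscore S).
Proof.
have mD : measurable ((trt : response R -> bool) @^-1` [set true]).
  by rewrite -[X in measurable X]setTI; exact: measurable_trt.
have := measurableT_comp (fine_measurable measurableT)
  (measurable_kernel (cond_law S) _ mD).
by apply: eq_measurable_fun => x _; rewrite pscoreE.
Qed.

Lemma tame_mj j : tame (fun z => mj S fY tau x10 j z.1).
Proof.
under eq_fun do rewrite mjE.
apply: tameM; last exact: tame_cst.
apply: tameB; last exact: tame_cst.
exact: tame_arm_cdf (measurable_quant_lin j).
Qed.

Lemma tame_sigma2_tau j : tame (fun z => sigma2_tau S fY tau x10 j z.1).
Proof.
under eq_fun do rewrite sigma2_tauE /=.
apply: tameM; last exact: tame_cst.
have tF : tame (fun z => arm_cdf S j z.1 (quant S j tau x10)).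
  exact: (@tame_arm_cdf j (fun=> quant S j tau x10)).
apply: tameM => //; apply: tameB => //; exact: tame_cst.
Qed.

Hypothesis A1 : assumption1 S.

Lemma tame_pscore : tame (fun z => pscore S z.1).
Proof.
split; first exact: (measurableT_comp measurable_pscore measurable_fst).
exists 1 => x v fx /=; have /andP[p0 p1] := pscore_bounds A1 fx.
by rewrite ger0_norm ltW.
Qed.

(** Overlap: p exceeds a positive constant on the support. *)
Lemma tame_inv_pscore : tame (fun z => (pscore S z.1)^-1).
Proof.
split.
  by apply: (measurableT_comp (@measurable_invr R)); exact: tame_pscore.1.
have [c c0 pc] := A1.2; exists c^-1 => x v [sx _] /=.
have /andP[cp _] := pc x sx.
have p0 := lt_trans c0 cp.
by rewrite gtr0_norm ?invr_gt0// lef_pV2 ?posrE// ltW.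
Qed.

Lemma tame_inv_pscoreC : tame (fun z => (1 - pscore S z.1)^-1).
Proof.
split.
  apply: (measurableT_comp (@measurable_invr R)).
  by apply: measurable_funB => //; exact: tame_pscore.1.
have [c c0 pc] := A1.2; exists c^-1 => x v [sx _] /=.
have /andP[_ pc1] := pc x sx.
have cp : c < 1 - pscore S x by rewrite ltrBrDl -ltrBrDr.
have p0 := lt_trans c0 cp.
by rewrite gtr0_norm ?invr_gt0// lef_pV2 ?posrE// ltW.
Qed.

Lemma tame_trt : tame (fun z => (trt z.2)%:R).
Proof.
apply: tame_bool; exact: (measurableT_comp measurable_trt measurable_snd).
Qed.

Lemma tame_psi : tame (fun z => psi S fY tau x10 (pscore S z.1) (observe z)).
Proof.
have teta j : tame (fun z => eta S fY tau x10 j (sub_X S z.1) (outcome z.2)).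
  apply: tameM; last exact: tame_cst.
  apply: tameB; last exact: tame_cst.
  apply: tame_bool; apply: measurable_fun_ler.
    exact: (measurableT_comp measurable_outcome measurable_snd).
  exact: (measurableT_comp (measurable_quant_lin j) measurable_fst).
apply: tameB; apply: tameM => //; apply: tameM.
- exact: tame_trt.
- exact: tame_inv_pscore.
- by apply: tameB; [exact: tame_cst|exact: tame_trt].
- exact: tame_inv_pscoreC.
Qed.

Lemma tame_n_p : tame (fun z => n_p S fY tau x10 z.1).
Proof.
apply: tameD; apply: tameM.
- exact: tame_mj.
- exact: tame_inv_pscore.
- exact: tame_mj.
- exact: tame_inv_pscoreC.
Qed.

Lemma tame_phi2 : tame (fun z => phi2 S fY tau x10 (observe z)).
Proof.
apply: tameB; first exact: tame_psi.
apply: tameM; first exact: tame_n_p.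
by apply: tameB; [exact: tame_trt|exact: tame_pscore].
Qed.

End regularity.

(** * Comparison of the two variances *)

Section variance_comparison.
Context {R : realType} {l m : nat} {d} {T : measurableType d}
  {P : probability T R}.
Variable S : setting l m P.
Variables (fY : bool -> 'rV[R]_l -> R -> R) (tau : R) (x10 : 'rV[R]_l).
Hypothesis A1 : assumption1 S.
Hypothesis dens_gt0 : 0 < dens_X1 S x10.
Local Notation p x := (pscore S x).
Local Notation mm j x := (mj S fY tau x10 j x).
Local Notation ss j x := (sigma2_tau S fY tau x10 j x).

(** The second moment of [phi2] given X = x, by [cond_E_phi2]. *)
Definition ncqte_variance x : R :=
  (mm true x - mm false x) ^+ 2 + ss true x / p x + ss false x / (1 - p x).

Definition variance_gap x : R :=
  p x * (1 - p x) * (mm true x / p x + mm false x / (1 - p x)) ^+ 2.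

Lemma pscore_itv x : 0 <= p x <= 1.
Proof.
rewrite pscoreE; apply: fine_prob_itv; first exact: prob_kernel.
by rewrite -[X in measurable X]setTI; exact: measurable_trt.
Qed.

Lemma sigma2_tau_ge0 j x : 0 <= ss j x.
Proof. by apply: Rintegral_ge0 => v _; exact: sqr_ge0. Qed.

Lemma tame_ncqte_variance : tame S x10 (fun z => ncqte_variance z.1).
Proof.
apply: tameD; first apply: tameD.
- by apply: tame_sqr; apply: tameB; exact: tame_mj.
- by apply: tameM; [exact: tame_sigma2_tau|exact: tame_inv_pscore].
- by apply: tameM; [exact: tame_sigma2_tau|exact: tame_inv_pscoreC].
Qed.

Lemma tame_variance_gap : tame S x10 (fun z => variance_gap z.1).
Proof.
apply: tameM; last by apply: tame_sqr; exact: tame_n_p.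
apply: tameM; first exact: tame_pscore.
by apply: tameB; [exact: tame_cst|exact: tame_pscore].
Qed.

Lemma ncqte_variance_ge0 x : 0 <= ncqte_variance x.
Proof.
have /andP[p0 p1] := pscore_itv x.
by rewrite !addr_ge0 ?sqr_ge0// mulr_ge0 ?sigma2_tau_ge0// invr_ge0 ?subr_ge0.
Qed.

Lemma variance_gap_ge0 x : 0 <= variance_gap x.
Proof.
have /andP[p0 p1] := pscore_itv x.
by rewrite mulr_ge0 ?sqr_ge0// mulr_ge0 ?subr_ge0.
Qed.

Lemma sigma2_ncqteE : sigma2_ncqte S fY tau x10 =
  cond_E1 S x10 (fun z => ncqte_variance z.1).
Proof.
have [mphi bphi] := tame_sqr (tame_phi2 fY tau x10 A1).
have [mv bv] := tame_ncqte_variance.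
apply: cond_E1_congr => //.
- by move=> z; exact: sqr_ge0.
- by move=> z; exact: ncqte_variance_ge0.
move=> x fx; rewrite cond_E_phi2//.
by rewrite (cond_E_cst _ _ ncqte_variance).
Qed.

(** The decomposition given X = x, integrated; additivity of the integral needs
both parts to be integrable, which [tame] provides. *)
Lemma sigma2_pcqteE : sigma2_pcqte S fY tau x10 =
  sigma2_ncqte S fY tau x10 + cond_E1 S x10 (fun z => variance_gap z.1).
Proof.
have [mpsi bpsi] := tame_sqr (tame_psi fY tau x10 A1).
have [mv bv] := tame_ncqte_variance.
have [mg bg] := tame_variance_gap.
have [mvg bvg] := tameD tame_ncqte_variance tame_variance_gap.
rewrite sigma2_ncqteE -RintegralD//; last 2 first.
- exact: integrable_cond_law1.
- exact: integrable_cond_law1.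
apply: cond_E1_congr => //.
- by move=> z; exact: sqr_ge0.
- by move=> z; rewrite addr_ge0// ?ncqte_variance_ge0// variance_gap_ge0.
move=> x fx; rewrite cond_E_psi//.
by rewrite (cond_E_cst _ _ (fun x => ncqte_variance x + variance_gap x)).
Qed.

End variance_comparison.

Theorem corollary2p1 (R : realType) (l m : nat) (hl : (0 < l)%N) (hm : (0 < m)%N)
  (d : measure_display) (T : measurableType d) (P : probability T R)
  (S : setting l m P)
  (fY : bool -> 'rV[R]_l -> R -> R) (hfY : is_cond_density S fY)
  (s1 s sstar : nat)
  (K : 'rV[R]_l -> R) (h : nat -> R)
  (dim : nat) (Theta : set 'rV[R]_dim)
  (pi : 'rV[R]_(l + m) -> 'rV[R]_dim -> R) (beta0 : 'rV[R]_dim)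
  (betahat : forall n : nat, n.-tuple (observed R (l + m)) -> 'rV[R]_dim)
  (L : 'rV[R]_(l + m) -> R) (h0 : nat -> R)
  (A1 : assumption1 S)
  (A2 : assumption2 S s1 fY)
  (A3 : assumption3 S s1 fY)
  (A4 : assumption4 l m s1 s sstar K)
  (A5 : assumption5 l s1 h)
  (A6 : assumption6 S Theta pi beta0 betahat)
  (A7 : assumption7 S s L)
  (A8 : assumption8 l m s h0)
  (A9 : assumption9 l s h h0)
  (tau : R) (htau : 0 < tau < 1)
  (x10 : 'rV[R]_l) (hx10 : Omega S x10) :
  let p := pscore S in
  let m1 := mj S fY tau x10 true in
  let m0 := mj S fY tau x10 false in
  sigma2_ncqte S fY tau x10 =
    cond_E1 S x10 (fun z => (m1 z.1 - m0 z.1) ^+ 2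
      + sigma2_tau S fY tau x10 true z.1 / p z.1
      + sigma2_tau S fY tau x10 false z.1 / (1 - p z.1))
  /\
  (sigma2_pcqte S fY tau x10 =
    sigma2_ncqte S fY tau x10
    + cond_E1 S x10 (fun z => p z.1 * (1 - p z.1)
        * (m1 z.1 / p z.1 + m0 z.1 / (1 - p z.1)) ^+ 2)
   /\ sigma2_ncqte S fY tau x10 <= sigma2_pcqte S fY tau x10).
Proof.
have dens_gt0 : 0 < dens_X1 S x10.
  have [_ _ _ [[c [C [c0 dens_c]]] _] _] := A3.
  have /andP[cx _] := dens_c x10 (interior_subset hx10).
  exact: lt_le_trans c0 cx.
have pcqteE := sigma2_pcqteE fY tau A1 dens_gt0.
split; first exact: sigma2_ncqteE.
split; first exact: pcqteE.
rewrite pcqteE lerDl; apply: Rintegral_ge0 => z _.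
exact: variance_gap_ge0.
Qed.
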